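(* Let $(X,p_1)$ and $(Y,p_2)$ be asymmetric normed spaces. The closed unit ball $$B=\{b\in \mathcal{L}^2_{p_1,p_2;u}(X,Y): \|b|_{p_1,p_2;u}\le 1\}$$ of the cone of continuous bilinear forms on $X\times Y$ is $w^2$-compact.
   Context: An asymmetric norm on a real vector space $X$ is a functional $p:X\to[0,\infty)$ such that $p(x)=p(-x)=0\Rightarrow x=0$, $p(\alpha x)=\alpha p(x)$ and $p(x+y)\le p(x)+p(y)$ for all $x,y\in X$, $\alpha\ge 0$. It carries the topology $\tau(p)$ of the quasi-metric $d_p(x,y)=p(y-x)$: neighborhoods of $x$ are the sets containing a ball $\{y: d_p(x,y)<r\}$, $r>0$. Put $B_p=\{x: p(x)\le 1\}$. On $\mathbb{R}$ let $u$ be the asymmetric norm $u(\alpha)=\max\{\alpha,0\}$. $\mathcal{L}^2_{p_1,p_2;u}(X,Y)$ denotes the set of all bilinear forms $b:X\times Y\to\mathbb{R}$ that are continuous from $X\times Y$ with the product of the topologies $\tau(p_1)$ and $\tau(p_2)$ to $(\mathbb{R},\tau(u))$; it is a cone (closed under addition and multiplication by nonnegative scalars) and is normed by $$\|b|_{p_1,p_2;u}=\sup\{u(b(x,y)):(x,y)\in B_{p_1}\times B_{p_2}\}=\sup\{b(x,y):(x,y)\in B_{p_1}\times B_{p_2}\}.$$ The topology $w^2$ on $\mathcal{L}^2_{p_1,p_2;u}(X,Y)$ is the one for which, at each $b_0$, the sets $$V_{x,y;\varepsilon}(b_0)=\{b: b(x,y)-b_0(x,y)<\varepsilon\},\quad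 (x,y)\in X\times Y,\ \varepsilon>0,$$ form a neighborhood subbasis. *)

(* Defs.v *)
From HB Require Import structures.
From mathcomp Require Import all_boot all_order all_algebra finmap.
From mathcomp Require Import all_classical all_reals all_analysis.

Set Implicit Arguments.
Unset Strict Implicit.
Unset Printing Implicit Defensive.

Import Order.TTheory GRing.Theory Num.Theory.

Local Open Scope classical_set_scope.
Local Open Scope ring_scope.

Record asym_norm (R : realType) (X : lmodType R) := AsymNorm {
  asym_norm_fun :> X -> R;
  asym_norm_ge0 : forall x, 0 <= asym_norm_fun x;
  asym_norm_eq0 : forall x,
    asym_norm_fun x = 0 -> asym_norm_fun (- x) = 0 -> x = 0;
  asym_normZ : forall (a : R) x,
    0 <= a -> asym_norm_fun (a *: x) = a * asym_norm_fun x;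
  asym_normD : forall x y,
    asym_norm_fun (x + y) <= asym_norm_fun x + asym_norm_fun y
}.

(* A copy of X on which the topology tau(p) is declared; the norm is part of
   the type so that it never interferes with another topology on X. *)
Definition tau (R : realType) (X : lmodType R) (p : asym_norm X) : Type := X.

Section Tau.
Context (R : realType) (X : lmodType R) (p : asym_norm X).

Definition asym_ball (x : X) (r : R) : set X := [set y | p (y - x) < r].

Definition asym_unit_ball : set X := [set x | p x <= 1].

HB.instance Definition _ := Choice.copy (tau p) X.

Definition tau_nbhs (x : tau p) : set_system (tau p) :=
  filter_from [set r : R | 0 < r] (asym_ball x).

HB.instance Definition _ := hasNbhs.Build (tau p) tau_nbhs.

Lemma asym_norm0 : p 0 = 0.
Proof. by rewrite -[X in p X](scale0r 0) asym_normZ // mul0r. Qed.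

Lemma asym_ball_center (x : X) (r : R) : 0 < r -> asym_ball x r x.
Proof. by move=> r0; rewrite /asym_ball /= subrr asym_norm0. Qed.

Fact tau_nbhs_filter (x : tau p) : ProperFilter (tau_nbhs x).
Proof.
apply: filter_from_proper; last first.
  by move=> r r0; exists x; exact: asym_ball_center.
apply: filter_from_filter; first by exists 1; exact: ltr01.
move=> r s r0 s0; exists (Num.min r s); first by rewrite /= lt_min r0 s0.
by move=> y; rewrite /asym_ball /= lt_min => /andP.
Qed.

Fact tau_nbhs_singleton (x : tau p) (A : set (tau p)) : tau_nbhs x A -> A x.
Proof. by case=> r r0; apply; exact: asym_ball_center. Qed.

Fact tau_nbhs_nbhs (x : tau p) (A : set (tau p)) :
  tau_nbhs x A -> tau_nbhs x (tau_nbhs^~ A).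
Proof.
case=> r r0 rA; exists r => // y yr; exists (r - p ((y : X) - x)).
  by rewrite /= subr_gt0.
move=> z /=; rewrite /asym_ball /= ltrBrDr => zr; apply: rA.
rewrite /asym_ball /=; apply: le_lt_trans zr.
by apply: le_trans (asym_normD _ _ _); rewrite addrA subrK.
Qed.

HB.instance Definition _ := Nbhs_isNbhsTopological.Build (tau p)
  tau_nbhs_filter tau_nbhs_singleton tau_nbhs_nbhs.

End Tau.

Section AsymReal.
Context (R : realType).

Definition ureal_fun (a : R^o) : R := Num.max a 0.

Fact ureal_ge0 a : 0 <= ureal_fun a.
Proof. by rewrite /ureal_fun le_max lexx orbT. Qed.

Fact ureal_eq0 a : ureal_fun a = 0 -> ureal_fun (- a) = 0 -> a = 0.
Proof.
rewrite /ureal_fun => a0 Na0; apply/eqP; rewrite eq_le -{1}a0 le_max lexx /=.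
by rewrite -oppr_le0 -[leRHS]Na0 le_max lexx.
Qed.

Fact urealZ (c : R) (a : R^o) : 0 <= c -> ureal_fun (c *: a) = c * ureal_fun a.
Proof. by move=> c0; rewrite /ureal_fun maxr_pMr // mulr0. Qed.

Fact urealD a b : ureal_fun (a + b) <= ureal_fun a + ureal_fun b.
Proof.
rewrite {1}/ureal_fun ge_max addr_ge0 ?ureal_ge0 // andbT.
by rewrite lerD // /ureal_fun le_max lexx.
Qed.

Definition ureal : asym_norm R^o :=
  AsymNorm ureal_ge0 ureal_eq0 urealZ urealD.

End AsymReal.

Section ContinuousBilinearForms.
Context (R : realType) (X Y : lmodType R).
Context (p1 : asym_norm X) (p2 : asym_norm Y).

(* The continuity is joint: the domain carries the product topology. *)
Record cont_bilin := ContBilin {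
  cont_bilin_form :> {bilinear X -> Y -> R | *%R & *%R};
  cont_bilin_continuous :
    continuous (fun z : tau p1 * tau p2 =>
                  cont_bilin_form z.1 z.2 : tau (ureal R))
}.

HB.instance Definition _ := gen_eqMixin cont_bilin.
HB.instance Definition _ := gen_choiceMixin cont_bilin.

(* The supremum is taken in the extended reals, so that it is meaningful
   without a prior proof that the set is bounded. *)
Definition cont_bilin_norm (b : cont_bilin) : \bar R :=
  ereal_sup [set (ureal R (b z.1 z.2))%:E |
             z in asym_unit_ball p1 `*` asym_unit_ball p2].

Definition w2_subbasic (b0 : cont_bilin) (i : X * Y * R) : set cont_bilin :=
  [set b | b i.1.1 i.1.2 - b0 i.1.1 i.1.2 < i.2].

(* The filter generated by the finite intersections of the sets
   w2_subbasic b0 (x, y, e), e > 0. *)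
Definition w2_nbhs (b0 : cont_bilin) : set_system cont_bilin :=
  filter_from (finI_from [set i : X * Y * R | 0 < i.2] (w2_subbasic b0)) id.

HB.instance Definition _ := hasNbhs.Build cont_bilin w2_nbhs.

Fact w2_nbhs_center (b0 : cont_bilin) (A : set cont_bilin) :
  finI_from [set i : X * Y * R | 0 < i.2] (w2_subbasic b0) A -> A b0.
Proof.
by case=> D Dpos <- i /= /Dpos; rewrite inE /w2_subbasic /= subrr.
Qed.

Fact w2_nbhs_filter (b0 : cont_bilin) : ProperFilter (w2_nbhs b0).
Proof.
apply: filter_from_proper; last by move=> A /w2_nbhs_center; exists b0.
apply: filter_from_filter.
  by exists setT; exists fset0 => //; rewrite set_fset0 bigcap_set0.
by move=> A B fA fB; exists (A `&` B) => //; exact: finI_fromI.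
Qed.

Fact w2_nbhs_singleton (b0 : cont_bilin) (A : set cont_bilin) :
  w2_nbhs b0 A -> A b0.
Proof. by case=> B /w2_nbhs_center Bb0; exact. Qed.

Fact w2_nbhs_subbasic (b0 : cont_bilin) (x : X) (y : Y) (e : R) :
  0 < e -> w2_nbhs b0 (w2_subbasic b0 (x, y, e)).
Proof.
by move=> e0; exists (w2_subbasic b0 (x, y, e)) => //; exact: finI_from1.
Qed.

Fact w2_nbhs_nbhs (b0 : cont_bilin) (A : set cont_bilin) :
  w2_nbhs b0 A -> w2_nbhs b0 (w2_nbhs^~ A).
Proof.
case=> B fB BA; exists B => //; case: fB => D Dpos DB b /= Bb.
have FF := w2_nbhs_filter b; apply: filterS BA _; rewrite -DB.
apply: filter_bigI => -[[x y] e] iD.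
have /(_ (x, y, e) iD) : (\bigcap_(i in [set` D]) w2_subbasic b0 i) b.
  by rewrite DB.
rewrite /w2_subbasic /= => be.
have e0 : 0 < e - (b x y - b0 x y) by rewrite subr_gt0.
apply: filterS (w2_nbhs_subbasic b x y e0) => c; rewrite /w2_subbasic /=.
by rewrite ltrBrDr addrA subrK.
Qed.

HB.instance Definition _ := Nbhs_isNbhsTopological.Build cont_bilin
  w2_nbhs_filter w2_nbhs_singleton w2_nbhs_nbhs.

Definition cont_bilin_unit_ball : set cont_bilin :=
  [set b | (cont_bilin_norm b <= 1)%E].

End ContinuousBilinearForms.

Arguments cont_bilin_unit_ball {R X Y} p1 p2 _.

(* Main.v *)
(* By homogeneity, the forms in the unit ball are exactly the bilinear forms
   with b x y <= p1 x * p2 y, whose continuity is then automatic.  Since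
   - b x y = b (- x) y, the values b x y of such forms stay in the compact
   segment [- p1 (- x) * p2 y, p1 x * p2 y], so along an ultrafilter on the ball
   they converge pointwise; the limit is again bilinear with the same bound, and
   pointwise convergence implies w2-convergence. *)
From HB Require Import structures.
Require Import Defs.
From mathcomp Require Import all_boot all_order all_algebra.
From mathcomp Require Import all_classical all_reals all_analysis.
From mathcomp Require Import lra ring.

Set Implicit Arguments.
Unset Strict Implicit.
Unset Printing Implicit Defensive.

Import Order.TTheory GRing.Theory Num.Theory.
Import numFieldNormedType.Exports.

Local Open Scope classical_set_scope.
Local Open Scope ring_scope.

(** Compactness gives a cluster point of the image of [F] in [K]. Since [F] is an ultrafilter, it
    contains the preimage of a given neighborhood or of its complement; clustering excludes the
    complement, so the cluster point is a limit. *)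
Lemma ultra_compact_cvg (T : Type) (U : topologicalType) (F : set_system T)
    (f : T -> U) (K : set U) :
  UltraFilter F -> compact K -> F (f @^-1` K) ->
  exists2 l, K l & f @ F --> l.
Proof.
move=> UF cK FK; have [l [Kl cl]] := cK (f @ F) _ FK.
exists l => // B Bl.
have [//|FnB] := in_ultra_setVsetC (f @^-1` B) UF.
by have [y [/= nBy By]] := cl (~` B) B FnB Bl.
Qed.

Lemma small_mul_add (R : realType) (s r : R) : 0 <= s -> 0 < r ->
  exists2 d, 0 < d & d * (d + s) < r.
Proof.
move=> s0 r0; have t0 : 0 < s + 2 by lra.
(* As [d <= 1], [d * (d + s) <= d * (1 + s) < d * (s + 2) <= r]. *)
pose d := Num.min 1 (r / (s + 2)).
have d0 : 0 < d by rewrite lt_min ltr01 divr_gt0.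
have d1 : d <= 1 by rewrite ge_min lexx.
exists d => //; have : d * (s + 2) <= r; last by nra.
by rewrite -ler_pdivlMr // ge_min lexx orbT.
Qed.

Section Bound.
Context (R : realType) (X Y : lmodType R).
Context (p1 : asym_norm X) (p2 : asym_norm Y).

Lemma bilinear_le_continuous (b : {bilinear X -> Y -> R | *%R & *%R}) :
  (forall x y, b x y <= p1 x * p2 y) ->
  continuous (fun z : tau p1 * tau p2 => b z.1 z.2 : tau (ureal R)).
Proof.
move=> b_le [x y] A [r /= r0 rA].
have [d d0 dr] := small_mul_add
  (addr_ge0 (asym_norm_ge0 p1 x) (asym_norm_ge0 p2 y)) r0.
exists (asym_ball p1 x d, asym_ball p2 y d).
  by split; exists d.
move=> [x' y'] [/= x'd y'd]; apply: rA.
rewrite /asym_ball /= /ureal_fun gt_max r0 andbT.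
rewrite /asym_ball /= in x'd y'd.
(* Only the forward differences [x' - x] and [y' - y] occur, so the bound on [b] makes the sum at
   most [d * (d + (p1 x + p2 y)) < r]. *)
have -> : b x' y' - b x y =
    b (x' - x) (y' - y) + b x (y' - y) + b (x' - x) y.
  by rewrite !linearBl !linearBr /=; ring.
have := asym_norm_ge0 p1 x; have := asym_norm_ge0 p2 y.
have := asym_norm_ge0 p1 (x' - x); have := asym_norm_ge0 p2 (y' - y).
have := b_le (x' - x) (y' - y); have := b_le x (y' - y).
have := b_le (x' - x) y.
nra.
Qed.

Lemma cont_bilin_unit_ballP (b : cont_bilin p1 p2) :
  cont_bilin_unit_ball p1 p2 b <-> forall x y, b x y <= p1 x * p2 y.
Proof.
split=> [b1 x y|b_le]; last first.
  apply: ge_ereal_sup => _ [[x y] [/= x1 y1] <-].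
  rewrite lee_fin /ureal_fun ge_max ler01 andbT (le_trans (b_le x y)) //.
  by rewrite mulr_ile1 // asym_norm_ge0.
have ball_le x' y' : p1 x' <= 1 -> p2 y' <= 1 -> b x' y' <= 1.
  move=> x1 y1; have : ((ureal_fun (b x' y'))%:E <= 1)%E.
    by apply: le_trans b1; apply: ereal_sup_ubound; exists (x', y').
  by rewrite lee_fin ge_max => /andP[].
have p10 := asym_norm_ge0 p1 x; have p20 := asym_norm_ge0 p2 y.
(* Since [p1 x] or [p2 y] may vanish, the vectors are scaled by [p1 x + d] and [p2 y + d]; the
   product of these exceeds [p1 x * p2 y] by [d * (d + (p1 x + p2 y)) < e]. *)
apply/ler_addgt0Pr => e e0.
have [d d0 de] := small_mul_add (addr_ge0 p10 p20) e0.
have s0 : 0 < p1 x + d by lra.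
have t0 : 0 < p2 y + d by lra.
have : b ((p1 x + d)^-1 *: x) ((p2 y + d)^-1 *: y) <= 1.
  apply: ball_le; rewrite asym_normZ ?ler_pdivrMl ?invr_ge0 //; lra.
rewrite linearZl_LR linearZr_LR /= mulrA -invfM ler_pdivrMl ?mulr_gt0 //.
by move=> /le_trans; apply; nra.
Qed.

(** A basic neighborhood of [b] is a finite intersection of conditions [c x y < b x y + e], each of
    which holds eventually along [F]. *)
Lemma w2_cvg (F : set_system (cont_bilin p1 p2)) (b : cont_bilin p1 p2) :
  Filter F -> (forall x y, (fun c : cont_bilin p1 p2 => c x y) @ F --> b x y) ->
  F --> b.
Proof.
move=> FF Fb A [B [D Dpos <-] BA]; apply: filterS BA _.
apply: filter_bigI => -[[x y] e] /Dpos; rewrite inE /= => e0.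
have : b x y < b x y + e by rewrite ltrDl.
move=> /(cvgr_lt _ (Fb x y)); apply: filterS => c /=.
by rewrite /w2_subbasic /= ltrBlDl.
Qed.

Lemma bilinear_for_cvg (F : set_system (cont_bilin p1 p2)) (f : X -> Y -> R) :
  ProperFilter F ->
  (forall x y, (fun c : cont_bilin p1 p2 => c x y) @ F --> f x y) ->
  bilinear_for *%R *%R f.
Proof.
move=> FF Ff; split=> [y a x x'|x a y y'].
- have : (fun c : cont_bilin p1 p2 => c (a *: x + x') y) @ F -->
      a * f x y + f x' y.
    under eq_fun do rewrite linearPl.
    by apply: cvgD => //; exact: cvgMr.
  exact: cvg_unique (Ff _ _).
- have : (fun c : cont_bilin p1 p2 => c x (a *: y + y')) @ F -->
      a * f x y + f x y'.
    under eq_fun do rewrite linearPr.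
    by apply: cvgD => //; exact: cvgMr.
  exact: cvg_unique (Ff _ _).
Qed.

End Bound.

Theorem theorem3p10 (R : realType) (X Y : lmodType R)
    (p1 : asym_norm X) (p2 : asym_norm Y) :
  compact (cont_bilin_unit_ball p1 p2).
Proof.
rewrite compact_ultra => F UF FB.
have FP : ProperFilter F by exact: ultra_proper.
have lim x y : exists l : R, l <= p1 x * p2 y /\
    (fun c : cont_bilin p1 p2 => c x y) @ F --> l.
  have [|l] := ultra_compact_cvg UF
    (@segment_compact R (- (p1 (- x) * p2 y)) (p1 x * p2 y))
    (f := fun c : cont_bilin p1 p2 => c x y : R).
    apply: filterS FB => c /cont_bilin_unit_ballP c_le.
    by rewrite /= in_itv /= c_le lerNl -linearNl c_le.
  by rewrite /= in_itv /= => /andP[_ l_le] Fl; exists l.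
have [g g_lim] := choice (fun z : X * Y => lim z.1 z.2).
pose f x y := g (x, y).
have Ff x y : (fun c : cont_bilin p1 p2 => c x y) @ F --> f x y :=
  (g_lim (x, y)).2.
pose f_bilin := bilinear_isBilinear.Build _ _ _ _ _ _ f
  (bilinear_for_cvg FP Ff).
pose f_form : {bilinear X -> Y -> R | *%R & *%R} := HB.pack f f_bilin.
(* This bound serves twice: for the continuity of the limit form and for its membership in the
   ball. *)
have f_le x y : f_form x y <= p1 x * p2 y := (g_lim (x, y)).1.
exists (ContBilin (bilinear_le_continuous f_le)); split.
  exact/cont_bilin_unit_ballP.
exact: w2_cvg.
Qed.
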